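(* Suppose $(\sigma,\tau)$ is a disconnected interval in the permutation pattern poset. Then for any permutation $\alpha$, the open interval $(\alpha\oplus\sigma,\ \alpha\oplus\tau)$ is also disconnected.
   Context: The permutation pattern poset is the set of all permutations of $\{1,\dots,n\}$, $n>0$ (written as words), ordered by pattern containment: $\sigma\le\tau$ if $\tau$ has a subsequence whose letters appear in the same relative order of size as those of $\sigma$. $(\sigma,\tau)=\{\pi:\sigma<\pi<\tau\}$; it is disconnected if its order complex (simplicial complex of chains) is disconnected, i.e. it is the disjoint union of two nonempty subsets with no element of one comparable to an element of the other. The direct sum $\alpha\oplus\beta$ is the concatenation of $\alpha$ and $\beta'$, where $\beta'$ is obtained from $\beta$ by adding to each of its letters the largest letter of $\alpha$. *)

(* Defs.v *)
From HB Require Import structures.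
From mathcomp Require Import all_boot all_order all_algebra.

Set Implicit Arguments.
Unset Strict Implicit.
Unset Printing Implicit Defensive.

Import Order.TTheory.

Local Open Scope nat_scope.

Definition is_permword (w : seq nat) : bool :=
  (0 < size w) && perm_eq w (iota 1 (size w)).

(* Permutations of {1, ..., n} for all n > 0, in one-line notation. *)
Record permword : Type := PermWord {
  word :> seq nat;
  permwordP : is_permword word
}.

HB.instance Definition _ := [isSub for word].
HB.instance Definition _ := [Choice of permword by <:].

Definition order_iso (u v : seq nat) : bool :=
  (size u == size v) &&
  [forall i : 'I_(size u), forall j : 'I_(size u),
     (nth 0 u i < nth 0 u j) == (nth 0 v i < nth 0 v j)].

(* The masks m enumerate the subsequences of t; see containsP. *)
Definition contains (s t : permword) : bool :=
  [exists m : (size t).-tuple bool, order_iso s (mask m t)].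

Lemma order_isoP (u v : seq nat) :
  reflect (size u = size v /\
           forall i j, i < size u -> j < size u ->
             (nth 0 u i < nth 0 u j) = (nth 0 v i < nth 0 v j))
          (order_iso u v).
Proof.
apply: (iffP andP) => [[/eqP sz /forallP h]|[sz h]]; split => //.
- move=> i j hi hj.
  by move/forallP/(_ (Ordinal hj))/eqP: (h (Ordinal hi)).
- exact/eqP.
- by apply/forallP => i; apply/forallP => j; rewrite h.
Qed.

Lemma containsP (s t : permword) :
  reflect (exists2 u, subseq u t & order_iso s u) (contains s t).
Proof.
apply: (iffP existsP) => [[m h]|[u /subseqP [m sz ->] h]].
  by exists (mask m t) => //; exact: mask_subseq.
have sz' : size m == size t by apply/eqP.
by exists (Tuple sz').
Qed.

Lemma order_iso_refl u : order_iso u u.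
Proof. exact/order_isoP. Qed.

Lemma order_iso_trans u v w :
  order_iso u v -> order_iso v w -> order_iso u w.
Proof.
move=> /order_isoP [s1 h1] /order_isoP [s2 h2]; apply/order_isoP.
split=> [|i j hi hj]; first by rewrite s1.
by rewrite h1 // h2 // -s1.
Qed.

Lemma order_iso_mask m u v :
  order_iso u v -> order_iso (mask m u) (mask m v).
Proof.
move=> /order_isoP [sz h]; apply/order_isoP.
pose r := mask m (iota 0 (size u)).
have eu : mask m u = map (nth 0 u) r.
  by rewrite map_mask; congr mask; rewrite -[LHS](mkseq_nth 0).
have ev : mask m v = map (nth 0 v) r.
  by rewrite map_mask; congr mask; rewrite -[LHS](mkseq_nth 0) -sz.
have hr i : i < size r -> nth 0 r i < size u.
  by move=> /(mem_nth 0) /mem_mask; rewrite mem_iota.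
rewrite eu ev !size_map; split=> // i j hi hj.
by rewrite !(nth_map 0) // h ?hr.
Qed.

Lemma contains_refl : reflexive contains.
Proof. by move=> s; apply/containsP; exists s => //; exact: order_iso_refl. Qed.

Lemma contains_trans : transitive contains.
Proof.
move=> t s p /containsP [u /subseqP [m sm ->] su] /containsP [v vp tv].
apply/containsP; exists (mask m v).
  exact: subseq_trans (mask_subseq m v) vp.
exact: order_iso_trans su (order_iso_mask m tv).
Qed.

Lemma nth_permword (w : seq nat) i :
  is_permword w -> i < size w ->
  nth 0 w i = (count (fun x => x < nth 0 w i) w).+1.
Proof.
case/andP=> _ hp hi.
have : nth 0 w i \in iota 1 (size w) by rewrite -(perm_mem hp) mem_nth.
rewrite (permP hp) mem_iota add1n ltnS => /andP [x0 xn].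
set x := nth 0 w i in x0 xn *.
have -> : iota 1 (size w) = iota 1 x.-1 ++ iota x (size w - x.-1).
  by rewrite -[in iota x _](prednK x0) -[x.-1.+1]add1n -iotaD subnKC //
     (leq_trans (leq_pred x)).
rewrite count_cat.
have -> : count (fun y => y < x) (iota 1 x.-1) = x.-1.
  rewrite -[RHS](size_iota 1 x.-1); apply/eqP; rewrite -all_count.
  by apply/allP => y; rewrite mem_iota add1n prednK // => /andP [].
have -> : count (fun y => y < x) (iota x (size w - x.-1)) = 0.
  apply/eqP; rewrite -leqn0 leqNgt -has_count; apply/hasPn => y.
  by rewrite mem_iota => /andP [xy _]; rewrite -leqNgt.
by rewrite addn0 prednK.
Qed.

Lemma order_iso_permword (u v : seq nat) :
  is_permword u -> is_permword v -> order_iso u v -> u = v.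
Proof.
move=> pu pv /order_isoP [sz h]; apply: (@eq_from_nth _ 0) => // i hi.
rewrite (nth_permword pu) // (nth_permword pv) -?sz //; congr _.+1.
have ew p (w : seq nat) : count p w = count (p \o nth 0 w) (iota 0 (size w)).
  by rewrite -{1}(mkseq_nth 0 w) /mkseq count_map.
rewrite [LHS]ew [RHS]ew -sz; apply: eq_in_count => j.
by rewrite mem_iota => /= hj; rewrite h.
Qed.

Lemma contains_anti : antisymmetric contains.
Proof.
move=> s t /andP [/containsP [u ut su] /containsP [v vs tv]].
have [e1 _] := order_isoP _ _ su; have [e2 _] := order_isoP _ _ tv.
have l1 := size_subseq ut; have l2 := size_subseq vs.
have e : u = t.
  apply/eqP; rewrite -(size_subseq_leqif ut) eqn_leq l1 /=.
  by rewrite -e1 e2.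
rewrite e in su; apply: val_inj.
exact: order_iso_permword (permwordP s) (permwordP t) su.
Qed.

Fact pattern_display : Order.disp_t. Proof. exact: Order.Disp tt tt. Qed.

HB.instance Definition _ :=
  Order.Le_isPOrder.Build pattern_display permword
    contains_refl contains_anti contains_trans.

Definition dsum_word (a b : seq nat) : seq nat :=
  a ++ [seq x + \max_(y <- a) y | x <- b].

Lemma max_permword (a : seq nat) : is_permword a -> \max_(y <- a) y = size a.
Proof.
case/andP=> a0 hp; rewrite (perm_big _ hp) /=; apply/eqP.
rewrite eqn_leq; apply/andP; split.
  by apply/bigmax_leqP_seq => i; rewrite mem_iota add1n ltnS => /andP [].
apply: (@leq_bigmax_seq _ _ _ (fun y => y)) => //.
by rewrite mem_iota a0 add1n ltnS leqnn.
Qed.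

Lemma dsum_wordP (a b : permword) : is_permword (dsum_word a b).
Proof.
rewrite /dsum_word (max_permword (permwordP a)).
case/andP: (permwordP a) => a0 pa; case/andP: (permwordP b) => _ pb.
rewrite /is_permword size_cat size_map addn_gt0 a0 /= iotaD.
apply: perm_cat => //; rewrite addnC iotaDl.
rewrite (eq_map (fun x => addnC x (size a))).
exact: perm_map.
Qed.

Definition dsum (a b : permword) : permword := PermWord (dsum_wordP a b).

Definition disconnected (d : Order.disp_t) (T : porderType d)
    (I : interval T) : Prop :=
  exists A B : T -> Prop,
    [/\ exists x, A x,
        exists x, B x,
        forall x, x \in I <-> A x \/ B x,
        forall x, ~ (A x /\ B x)
      & forall x y, A x -> B y -> (x >< y)%O].

(* Main.v *)
Require Import Defs.
From mathcomp Require Import all_boot all_order all_algebra.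
From Stdlib Require Import Classical.
From mathcomp Require Import zify.

(** Since the direct sum is associative, it is enough to treat a
    sum-indecomposable [alpha] and to peel off the components of a general
    [alpha] one at a time.  For such an [alpha], the elements below
    [alpha (+) tau] fall into two classes ([le_dsum_cases]).  Some are of the
    form [alpha (+) t]; by cancellation ([dsum_le2l]) those in the open
    interval form a copy of [(sigma, tau)].  For any other [p] there, the part
    of [p] lying in the first summand is a proper pattern of [alpha].  An
    occurrence of [alpha (+) s] in [p] cannot then place [alpha] there, nor
    straddle the two summands because [alpha] is indecomposable, so the whole
    of [alpha (+) s] lies in the part of [p] that comes from [tau].

    Let [A], [B] disconnect [(sigma, tau)], named so that [alpha (+) sigma] is
    not in [B].  Then [alpha (+) B] is closed under comparability inside the new
    interval, and so separates from the rest.  Take [b] in [B] and an element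
    [p] of the second class comparable with [alpha (+) b].
    - If [p <= alpha (+) b], then [p >= alpha (+) sigma] forces
      [alpha (+) sigma <= b], which puts [alpha (+) sigma] in [B].
    - If [alpha (+) b <= p], then [alpha (+) b <= tau], so that
      [alpha (+) sigma] lies strictly below [tau], hence in [A].  When
      [alpha (+) b < tau], the chains [b < alpha (+) b] and
      [alpha (+) sigma < alpha (+) b] connect [B] to [A].  When
      [alpha (+) b = tau] and [alpha] has at least two letters, the elements
      [1 (+) b] and [1 (+) sigma] give the path
      [b < 1 (+) b > 1 (+) sigma < alpha (+) sigma], again from [B] to [A].
      When [alpha (+) b = tau] and [alpha = 1], there is no room between
      [tau] and [1 (+) tau], so [p = tau = alpha (+) b]. *)

Set Implicit Arguments.
Unset Strict Implicit.
Unset Printing Implicit Defensive.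

Import Order.TTheory.
Local Open Scope nat_scope.

(** * Order-isomorphic words *)

Lemma order_iso_sym u v : order_iso u v -> order_iso v u.
Proof.
move=> /order_isoP [sz h]; apply/order_isoP; split=> // i j hi hj.
by rewrite h ?sz.
Qed.

Lemma order_iso_size u v : order_iso u v -> size u = size v.
Proof. by move=> /order_isoP []. Qed.

Lemma order_iso_take k u v : order_iso u v -> order_iso (take k u) (take k v).
Proof.
move=> /order_isoP [sz h]; apply/order_isoP; split; first by rewrite !size_take sz.
move=> i j; rewrite !size_take_min => hi hj.
by rewrite !nth_take ?h //; lia.
Qed.

Lemma order_iso_drop k u v : order_iso u v -> order_iso (drop k u) (drop k v).
Proof.
move=> /order_isoP [sz h]; apply/order_isoP; split; first by rewrite !size_drop sz.
move=> i j; rewrite !size_drop => hi hj.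
by rewrite !nth_drop h //; lia.
Qed.

Lemma order_iso_allrel k u v :
  order_iso u v -> allrel ltn (take k v) (drop k v) ->
  allrel ltn (take k u) (drop k u).
Proof.
move=> /order_isoP [sz h] /allrelP hv; apply/allrelP => x y.
move=> /(nthP 0) [i hi <-] /(nthP 0) [j hj <-].
rewrite size_take_min leq_min in hi; rewrite size_drop ltn_subRL in hj.
have /andP [ik iu] := hi.
rewrite nth_take // nth_drop /= h; [|by []|by []].
rewrite -[nth 0 v (k + j)]nth_drop -(@nth_take k _ 0 i) //.
apply: hv; apply: mem_nth; rewrite ?size_take_min ?size_drop -sz //.
  by rewrite leq_min ik.
by rewrite ltn_subRL.
Qed.

Lemma order_iso_cat u1 u2 w1 w2 :
  order_iso u1 w1 -> order_iso u2 w2 -> allrel ltn u1 u2 -> allrel ltn w1 w2 ->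
  order_iso (u1 ++ u2) (w1 ++ w2).
Proof.
move=> /order_isoP [s1 h1] /order_isoP [s2 h2] /allrelP hu /allrelP hw.
apply/order_isoP; split; first by rewrite !size_cat s1 s2.
move=> i j; rewrite !size_cat !nth_cat -s1 => hi hj.
have cross a b : a < size u1 -> b < size u2 ->
    nth 0 u1 a < nth 0 u2 b /\ nth 0 w1 a < nth 0 w2 b.
  by move=> ha hb; split; [apply: hu|apply: hw]; apply: mem_nth;
     rewrite -?s1 -?s2.
case: (ltnP i (size u1)) => li; case: (ltnP j (size u1)) => lj.
- exact: h1.
- by have [] := cross i (j - size u1); lia.
- by have [] := cross j (i - size u1); lia.
- by apply: h2; lia.
Qed.

Definition standardize (w : seq nat) : seq nat :=
  [seq (count (fun y => y < x) w).+1 | x <- w].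

Lemma ltn_count (w : seq nat) x y :
  x \in w -> (count (fun z => z < x) w < count (fun z => z < y) w) = (x < y).
Proof.
have mono a b : a <= b -> count (fun z => z < a) w <= count (fun z => z < b) w.
  by move=> ab; apply: sub_count => z /= /leq_trans; apply.
move=> xw; case: (ltnP x y) => xy; last by apply/negbTE; rewrite -leqNgt mono.
apply: (@leq_trans (count (fun z => z < x.+1) w)); last exact: mono.
have -> : count (fun z => z < x.+1) w = count (predU (pred1 x) (fun z => z < x)) w.
  by apply: eq_count => z; exact: leq_eqVlt.
have := count_predUI (pred1 x) (fun z => z < x) w.
rewrite [count (predI _ _) _](@eq_count _ _ pred0) ?count_pred0; last first.
  by move=> z /=; case: eqP => //= ->; rewrite ltnn.
rewrite addn0 => ->.
by rewrite -[X in X < _]add0n ltn_add2r -has_count has_pred1.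
Qed.

(** The number of letters of [w] smaller than [x] is strictly increasing in
    [x], for [x] among the letters of [w]. *)
Lemma standardize_iso w : order_iso (standardize w) w.
Proof.
apply/order_isoP; rewrite /standardize size_map; split=> // i j hi hj.
by rewrite !(nth_map 0) // ltnS ltn_count // mem_nth.
Qed.

Lemma standardize_permword w : uniq w -> 0 < size w -> is_permword (standardize w).
Proof.
move=> uw w0; rewrite /is_permword size_map w0 /=.
have us : uniq (standardize w).
  rewrite map_inj_in_uniq // => x y xw yw [] e.
  by have := ltn_count y xw; have := ltn_count x yw; rewrite e ltnn; lia.
apply: uniq_perm => //; first exact: iota_uniq.
apply: (uniq_min_size us _ _).2; last by rewrite size_map size_iota.
move=> _ /mapP [x xw ->]; rewrite mem_iota add1n !ltnS /=.
rewrite -(count_predC (fun y => y < x)) -[X in X < _]addn0 ltn_add2l.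
by rewrite -has_count; apply/hasP; exists x; rewrite //= ltnn.
Qed.

Lemma permword_uniq (p : permword) : uniq p.
Proof.
by case/andP: (permwordP p) => _ /perm_uniq ->; exact: iota_uniq.
Qed.

Lemma permword_size_gt0 (p : permword) : 0 < size p.
Proof. by case/andP: (permwordP p). Qed.

Lemma exists_standardization w :
  uniq w -> 0 < size w -> exists p : permword, order_iso p w.
Proof.
move=> uw w0; exists (PermWord (standardize_permword uw w0)).
exact: standardize_iso.
Qed.

Lemma permword_eq (p q : permword) : order_iso p q -> p = q.
Proof.
by move=> h; apply/val_inj/order_iso_permword => //; exact: permwordP.
Qed.

(** * Pattern containment of words *)

Definition pattern (u v : seq nat) : Prop :=
  exists2 w, subseq w v & order_iso u w.

Lemma le_patternP (s t : permword) : reflect (pattern s t) (s <= t)%O.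
Proof. exact: containsP. Qed.

Lemma pattern_iso u v : order_iso u v -> pattern u v.
Proof. by exists v. Qed.

Lemma subseq_pattern u v : subseq u v -> pattern u v.
Proof. by exists u => //; exact: order_iso_refl. Qed.

Lemma pattern_size u v : pattern u v -> size u <= size v.
Proof. by case=> w /size_subseq h /order_iso_size ->. Qed.

Lemma pattern_trans v u w : pattern u v -> pattern v w -> pattern u w.
Proof.
case=> u' /subseqP [m _ ->] h1 [v' h2 h3]; exists (mask m v').
  exact: subseq_trans (mask_subseq m v') h2.
exact: order_iso_trans h1 (order_iso_mask m h3).
Qed.

Lemma pattern_size_eq u v : pattern u v -> size v <= size u -> order_iso u v.
Proof.
case=> w wv h sz; suff <- : w = v by [].
by apply/eqP; rewrite -(size_subseq_leqif wv) eqn_leq size_subseq // -(order_iso_size h).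
Qed.

Lemma pattern_cat u1 u2 v1 v2 :
  pattern u1 v1 -> pattern u2 v2 -> allrel ltn u1 u2 -> allrel ltn v1 v2 ->
  pattern (u1 ++ u2) (v1 ++ v2).
Proof.
move=> [w1 s1 h1] [w2 s2 h2] hu /allrelP hv.
exists (w1 ++ w2); first exact: cat_subseq.
apply: order_iso_cat => //; apply/allrelP => x y xw yw.
by apply: hv; [exact: (mem_subseq s1)|exact: (mem_subseq s2)].
Qed.

(** An occurrence of [u] in a direct sum is cut by the summands into a prefix
    and a suffix of [u], since the first summand also comes first. *)
Lemma pattern_cat_split u v1 v2 :
  pattern u (v1 ++ v2) -> allrel ltn v1 v2 ->
  exists k, [/\ k <= size u, pattern (take k u) v1, pattern (drop k u) v2
              & allrel ltn (take k u) (drop k u)].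
Proof.
case=> w /subseqP [m sm ->] h /allrelP hv.
rewrite size_cat in sm.
rewrite -(cat_take_drop (size v1) m) mask_cat in h; last first.
  by rewrite size_takel // sm leq_addr.
set w1 := mask _ v1 in h; set w2 := mask _ v2 in h.
have s1 : subseq w1 v1 by exact: mask_subseq.
have s2 : subseq w2 v2 by exact: mask_subseq.
exists (size w1); split.
- by rewrite (order_iso_size h) size_cat leq_addr.
- by exists w1 => //; move: (order_iso_take (size w1) h); rewrite take_size_cat.
- by exists w2 => //; move: (order_iso_drop (size w1) h); rewrite drop_size_cat.
- apply: (order_iso_allrel h); rewrite take_size_cat // drop_size_cat //.
  apply/allrelP => x y xw yw.
  by apply: hv; [exact: (mem_subseq s1)|exact: (mem_subseq s2)].
Qed.

(** * Direct sums *)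

Lemma word_dsum (a b : permword) :
  dsum a b = a ++ [seq x + size a | x <- b] :> seq nat.
Proof. by rewrite /= /dsum_word max_permword // permwordP. Qed.

(** This form keeps only what containment arguments use: the second block is
    a copy of [b] placed above the first. *)
Lemma dsum_cat (a b : permword) :
  exists d, [/\ dsum a b = a ++ d :> seq nat, order_iso b d & allrel ltn a d].
Proof.
exists [seq x + size a | x <- b]; split; first exact: word_dsum.
  apply/order_isoP; rewrite size_map; split=> // i j hi hj.
  by rewrite !(nth_map 0) // ltn_add2r.
apply/allrelP => x _ xa /mapP [y yb ->].
have ym : 0 < y.
  case/andP: (permwordP b) => _ /perm_mem h.
  by move: yb; rewrite h mem_iota => /andP [].
have : x <= size a.
  by rewrite -(max_permword (permwordP a)) (@leq_bigmax_seq _ _ predT id).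
by rewrite /=; lia.
Qed.

Lemma size_dsum (a b : permword) : size (dsum a b) = size a + size b.
Proof. by have [d [-> /order_iso_size -> _]] := dsum_cat a b; rewrite size_cat. Qed.

Lemma dsum_unique (p a b : permword) u v :
  p = u ++ v :> seq nat -> order_iso u a -> order_iso v b -> allrel ltn u v ->
  p = dsum a b.
Proof.
move=> e ha hb huv; apply: permword_eq.
have [d [-> hd had]] := dsum_cat a b.
by rewrite e; apply: order_iso_cat => //; exact: order_iso_trans hb hd.
Qed.

Lemma dsumA (a b c : permword) : dsum (dsum a b) c = dsum a (dsum b c).
Proof.
apply: permword_eq; rewrite (word_dsum (dsum a b)) size_dsum !word_dsum.
rewrite map_cat -map_comp catA.
rewrite (@eq_map _ _ (_ \o _) (fun x => x + (size a + size b))) ?order_iso_refl //.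
by move=> x /=; rewrite addnAC addnA.
Qed.

Lemma dsum_leS (a a' b b' : permword) :
  (a <= a')%O -> (b <= b')%O -> (dsum a b <= dsum a' b')%O.
Proof.
move=> /le_patternP ha /le_patternP hb; apply/le_patternP.
have [d [-> hd had]] := dsum_cat a b; have [d' [-> hd' had']] := dsum_cat a' b'.
apply: pattern_cat => //.
apply: (pattern_trans (v := b')); last exact: pattern_iso.
by apply: pattern_trans hb; apply: pattern_iso; exact: order_iso_sym.
Qed.

(** In an occurrence of [a (+) s] in [a (+) t], the first summand [a] receives
    at most [size a] letters, so all the letters of [s] fall into the second. *)
Lemma dsum_le2l (a s t : permword) : (dsum a s <= dsum a t)%O = (s <= t)%O.
Proof.
apply/idP/idP; last exact: dsum_leS.
move=> /le_patternP; have [d [-> hd _]] := dsum_cat a s.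
have [d' [-> hd' had']] := dsum_cat a t.
move=> /pattern_cat_split /(_ had') [k [hk /pattern_size h1 h2 _]]; apply/le_patternP.
have ka : k <= size a by move: h1; rewrite size_takel.
apply: (pattern_trans (pattern_iso hd)).
apply: (pattern_trans (v := drop k (a ++ d))).
  apply: subseq_pattern; rewrite drop_cat; case: ltnP => _.
    exact: suffix_subseq.
  by rewrite (eqP ka : k - size a = 0) drop0.
exact: pattern_trans h2 (pattern_iso (order_iso_sym hd')).
Qed.

Lemma lt_dsumr (a s : permword) : (s < dsum a s)%O.
Proof.
have [d [e hd _]] := dsum_cat a s; rewrite lt_neqAle; apply/andP; split.
  apply/eqP => /(congr1 (fun p : permword => size p)); rewrite size_dsum.
  by have := permword_size_gt0 a; lia.
apply/le_patternP; exists d => //; rewrite e; exact: suffix_subseq.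
Qed.

Lemma le_size (s t : permword) : (s <= t)%O -> size s <= size t.
Proof. by move=> /le_patternP /pattern_size. Qed.

Lemma le_size_eq (s t : permword) : (s <= t)%O -> size t <= size s -> s = t.
Proof. by move=> /le_patternP h sz; exact/permword_eq/pattern_size_eq. Qed.

Lemma dsum_lt2l (a s t : permword) : (dsum a s < dsum a t)%O = (s < t)%O.
Proof. by rewrite !lt_leAnge !dsum_le2l. Qed.

Lemma dsum_inj (a : permword) : injective (dsum a).
Proof. by move=> s t e; apply/le_anti/andP; split; rewrite -(dsum_le2l a) e lexx. Qed.

(** * Sum-indecomposable permutations *)

(** Stated for words by their cuts: a cut with all letters before it smaller
    than all letters after it is a nontrivial direct sum decomposition. *)
Definition indecomposable (a : seq nat) : Prop :=
  forall k, 0 < k < size a -> ~~ allrel ltn (take k a) (drop k a).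

Lemma indecomposable_or_dsum (a : permword) :
  indecomposable a \/
  exists a1 a2, [/\ a = dsum a1 a2, size a1 < size a & size a2 < size a].
Proof.
case: (boolP [exists k : 'I_(size a), (0 < k) && allrel ltn (take k a) (drop k a)]);
    last first.
  move=> /existsPn h; left=> k /andP [k0 ka].
  by have := h (Ordinal ka); rewrite /= k0.
move=> /existsP [[k ka] /= /andP [k0 hk]]; right.
have [a1 h1] : exists p : permword, order_iso p (take k a).
  by apply: exists_standardization; rewrite ?take_uniq ?permword_uniq ?size_takel // ltnW.
have [a2 h2] : exists p : permword, order_iso p (drop k a).
  by apply: exists_standardization; rewrite ?drop_uniq ?permword_uniq ?size_drop ?subn_gt0.
have e : a = dsum a1 a2.
  apply: (dsum_unique _ (order_iso_sym h1) (order_iso_sym h2) hk).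
  by rewrite cat_take_drop.
exists a1, a2; split=> //; rewrite [in X in _ < X]e size_dsum.
- by have := permword_size_gt0 a2; lia.
- by have := permword_size_gt0 a1; lia.
Qed.

(** The block [a] cannot straddle the two summands, as that would cut it into a
    direct sum, and it does not fit into the first; hence it goes entirely to
    the second and takes [s] with it. *)
Lemma pattern_cat_indecomposable a s v1 v2 :
  0 < size a -> indecomposable a -> allrel ltn v1 v2 -> ~ pattern a v1 ->
  pattern (a ++ s) (v1 ++ v2) -> pattern (a ++ s) v2.
Proof.
move=> a0 ia hv na /pattern_cat_split /(_ hv) [k [hk h1 h2 huv]].
case: (posnP k) => [k0|k0]; first by move: h2; rewrite k0 drop0.
case: (leqP (size a) k) => ka.
  case: na; apply: pattern_trans h1; apply: subseq_pattern.
  rewrite take_cat ltnNge ka /=; exact: prefix_subseq.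
have /negP ncut : ~~ allrel ltn (take k a) (drop k a) by apply: ia; rewrite k0.
case: ncut.
move: huv; rewrite take_cat drop_cat ka allrel_catr => /andP [] //.
Qed.

(** If the part of [p] inside the summand [alpha] is all of [alpha], the rest
    of [p] is [t1], or is empty and the second case holds vacuously.
    Otherwise [alpha] does not fit into that part, and the occurrences of
    [alpha (+) s] in [p] are forced into [t]. *)
Lemma le_dsum_cases (alpha t p : permword) :
  indecomposable alpha -> (p <= dsum alpha t)%O ->
  (exists t1, p = dsum alpha t1) \/
  (forall s, (dsum alpha s <= p)%O -> (dsum alpha s <= t)%O).
Proof.
move=> ia /le_patternP; have [d [-> hd had]] := dsum_cat alpha t.
move=> /pattern_cat_split /(_ had) [k [hk h1 h2 huv]].
case: (leqP (size alpha) (size (take k p))) => sz; last first.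
  right=> s hs; apply/le_patternP.
  apply: pattern_trans (pattern_iso (order_iso_sym hd)).
  apply: pattern_trans h2.
  move/le_patternP: hs; have [ds [-> _ _]] := dsum_cat alpha s.
  rewrite -{1}(cat_take_drop k p); apply: pattern_cat_indecomposable => //.
    exact: permword_size_gt0.
  by move=> /pattern_size; rewrite leqNgt sz.
have h3 := pattern_size_eq h1 sz.
case: (posnP (size (drop k p))) => sd.
  (* Here [p] is [alpha] itself and is too short to contain any [alpha (+) s]. *)
  right=> s /le_size; rewrite size_dsum -(cat_take_drop k p) size_cat sd.
  by rewrite (order_iso_size h3); have := permword_size_gt0 s; lia.
have [t1 ht1] : exists q : permword, order_iso q (drop k p).
  by apply: exists_standardization => //; rewrite drop_uniq // permword_uniq.
left; exists t1; apply: (dsum_unique _ h3 (order_iso_sym ht1) huv).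
by rewrite cat_take_drop.
Qed.

(** * Disconnected intervals *)

Fact perm1_subproof : is_permword [:: 1]. Proof. by []. Qed.

Definition perm1 : permword := PermWord perm1_subproof.

Lemma perm1_le (a : permword) : (perm1 <= a)%O.
Proof.
apply/le_patternP; case: a => [[|x a] ha] //=; exists [:: x].
  by rewrite /= eqxx sub0seq.
by apply/order_isoP; split=> // -[|i] [|j] //= _ _; rewrite !ltnn.
Qed.

(** The separated part of the new interval is the copy [alpha (+) B] of the
    side [B] not containing [alpha (+) sigma]; everything else, including the
    elements that are not of the form [alpha (+) t], goes to the other part. *)
Lemma disconnected_dsum_indecomposable (alpha sigma tau : permword) :
  indecomposable alpha -> disconnected (`]sigma, tau[%O) ->
  disconnected (`](dsum alpha sigma), (dsum alpha tau)[%O).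
Proof.
move=> ia [A [B [exA exB hI hAB inc]]].
wlog nB : A B exA exB hI hAB inc / ~ B (dsum alpha sigma).
  move=> H; case: (classic (B (dsum alpha sigma))) => [hB|]; last exact: (H A B).
  apply: (H B A) => //.
  - by move=> x; rewrite hI or_comm.
  - by move=> x [? ?]; apply: (hAB x).
  - by move=> x y ? ?; rewrite comparable_sym; apply: inc.
  - by move=> hA; apply: (hAB (dsum alpha sigma)).
have inI x : (sigma < x)%O -> (x < tau)%O -> A x \/ B x.
  by move=> h1 h2; apply/hI; rewrite in_itv /= h1.
have Ilt x : A x \/ B x -> (sigma < x < tau)%O.
  by move=> /hI; rewrite in_itv.
have notAB x y : A x -> B y -> ~~ (x <= y)%O /\ ~~ (y <= x)%O.
  by move=> hA hB; have := inc _ _ hA hB; rewrite negb_or => /andP.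
have Bup x y : A y \/ B y -> B x -> (x <= y)%O || (y <= x)%O -> B y.
  move=> [hy|//] hx; have [n1 n2] := notAB _ _ hy hx.
  by rewrite (negbTE n1) (negbTE n2).
pose C x := exists2 b, B b & x = dsum alpha b.
have CI x : C x -> (dsum alpha sigma < x < dsum alpha tau)%O.
  by move=> [b hb ->]; rewrite !dsum_lt2l; apply: Ilt; right.
(* No comparability in the new interval leaves [alpha (+) B]. *)
have closed x c : (dsum alpha sigma < x < dsum alpha tau)%O -> C c ->
    (x <= c)%O || (c <= x)%O -> C x.
  move=> hx [b hb ->] cmp.
  have form t : x = dsum alpha t -> C x.
    move=> e; exists t => //; move: hx cmp.
    rewrite e !dsum_lt2l !dsum_le2l => /andP [h1 h2] cmp.
    by apply: (Bup b) => //; [exact: inI|rewrite orbC].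
  case/andP: hx => sx xt; case/orP: cmp => cmp.
    case: (le_dsum_cases ia cmp) => [[t]|/(_ sigma (ltW sx)) sb]; first exact: form.
    case: nB; apply: (Bup b) => //; last by rewrite sb orbT.
    have /andP [_ bt] := Ilt b (or_intror hb).
    by apply: inI; [exact: lt_dsumr|exact: le_lt_trans bt].
  case: (le_dsum_cases ia (ltW xt)) => [[t]|/(_ b cmp) bt]; first exact: form.
  have /andP [sb _] := Ilt b (or_intror hb).
  have sbl : (dsum alpha sigma < dsum alpha b)%O by rewrite dsum_lt2l.
  have hA : A (dsum alpha sigma).
    have [] // := inI (dsum alpha sigma); first exact: lt_dsumr.
    exact: lt_le_trans bt.
  move: bt; rewrite le_eqVlt => /orP [/eqP bt|bt]; last first.
    have hB : B (dsum alpha b).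
      apply: (Bup b) => //; last by rewrite (ltW (lt_dsumr _ _)).
      by apply: inI => //; exact: lt_trans sb (lt_dsumr _ _).
    by have [] := notAB _ _ hA hB; rewrite (ltW sbl).
  case: (leqP (size alpha) 1) => a1; last first.
    (* The path b < 1 (+) b > 1 (+) sigma < alpha (+) sigma joins B to A. *)
    have lt1 s : (dsum perm1 s < dsum alpha s)%O.
      rewrite lt_neqAle dsum_leS ?perm1_le // andbT; apply/eqP.
      move=> /(congr1 (fun p : permword => size p)); rewrite !size_dsum /=; lia.
    have hB1 : B (dsum perm1 b).
      apply: (Bup b) => //; last by rewrite (ltW (lt_dsumr _ _)).
      by apply: inI; [exact: lt_trans (lt_dsumr _ _)|rewrite -bt].
    have s1b : (dsum perm1 sigma < dsum perm1 b)%O by rewrite dsum_lt2l.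
    have hB2 : B (dsum perm1 sigma).
      apply: (Bup (dsum perm1 b)) => //; last by rewrite (ltW s1b) orbT.
      apply: inI; first exact: lt_dsumr.
      by apply: lt_trans s1b _; rewrite -bt.
    by have [_] := notAB _ _ hA hB2; rewrite (ltW (lt1 _)).
  (* Now alpha = 1 and alpha (+) b = tau, so x is squeezed between tau and
     1 (+) tau, which differ by one letter. *)
  exists b => //; apply/esym/le_size_eq => //; rewrite bt.
  have : size x < size (dsum alpha tau).
    rewrite ltnNge; apply/negP => /(le_size_eq (ltW xt)) e.
    by move: xt; rewrite e ltxx.
  by rewrite size_dsum; lia.
exists (fun x => (dsum alpha sigma < x < dsum alpha tau)%O /\ ~ C x), C; split.
- have [a ha] := exA; exists (dsum alpha a); split.
    by rewrite !dsum_lt2l; apply: Ilt; left.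
  by move=> [b hb /dsum_inj e]; apply: (hAB a); rewrite {2}e.
- by have [b hb] := exB; exists (dsum alpha b), b.
- move=> x; rewrite in_itv /=; split=> [h|[[]//|/CI //]].
  by case: (classic (C x)); [right|left].
- by move=> x [[]].
- move=> x y [hx nx] hy; apply/negP => cmp; apply: nx.
  by apply: (closed x y).
Qed.

Theorem theorem5p6 (sigma tau : permword)
    (hdisc : disconnected (`]sigma, tau[%O)) (alpha : permword) :
  disconnected (`](dsum alpha sigma), (dsum alpha tau)[%O).
Proof.
have [n] := ubnP (size alpha); elim: n alpha sigma tau hdisc => // n IHn.
move=> alpha sigma tau hdisc; rewrite ltnS => ha.
case: (indecomposable_or_dsum alpha) => [ia|[a1 [a2 [e h1 h2]]]].
  exact: disconnected_dsum_indecomposable.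
rewrite e !dsumA; have d2 := IHn a2 _ _ hdisc (leq_trans h2 ha).
exact: IHn a1 _ _ d2 (leq_trans h1 ha).
Qed.
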